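(* Let $u=(1,1,1)^{\mathsf T}$, and define the following sets of real symmetric $3\times3$ matrices $G=(g_{ij})$: \[ \mathcal D=\{G: G\succeq 0,\ g_{11},g_{22},g_{33}\le 1\},\qquad \mathcal K=\{G\in\mathcal D: u^{\mathsf T}Gu\le 1\}. \] Then \[ \max_{G\in\mathcal D}\det G=1\qquad\text{and}\qquad \max_{G\in\mathcal K}\det G=\frac{16}{27}, \] and the maximum over $\mathcal K$ is attained at \[ G_*=\begin{pmatrix}1&-1/3&-1/3\\-1/3&1&-1/3\\-1/3&-1/3&1\end{pmatrix}. \]
   Context: $G\succeq0$ means that $G$ is positive semidefinite. *)

(* Defs.v *)
From HB Require Import structures.
From mathcomp Require Import all_boot all_order all_algebra.
From mathcomp Require Import sesquilinear.
From mathcomp Require Import classical_sets reals.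

Set Implicit Arguments.
Unset Strict Implicit.
Unset Printing Implicit Defensive.

Import Order.TTheory GRing.Theory Num.Theory.

Local Open Scope classical_set_scope.
Local Open Scope ring_scope.

Section Defs.
Variable R : realType.

Definition qform n (G : 'M[R]_n) (x : 'cV[R]_n) : R :=
  (x^T *m G *m x) ord0 ord0.

Definition psd n (G : 'M[R]_n) : Prop :=
  G \is symmetricmx /\ forall x : 'cV[R]_n, 0 <= qform G x.

Definition all_ones : 'cV[R]_3 := const_mx 1.

Definition calD : set 'M[R]_3 :=
  [set G | psd G /\ forall i : 'I_3, G i i <= 1].

Definition calK : set 'M[R]_3 := [set G | calD G /\ qform G all_ones <= 1].

Definition Gstar : 'M[R]_3 :=
  \matrix_(i, j) (if i == j then 1 else - (1 / 3)).

(* An attained upper bound, so a maximum and not merely a supremum. *)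
Definition is_max T (A : set T) (f : T -> R) (m : R) : Prop :=
  (f @` A) m /\ ubound (f @` A) m.

End Defs.

Arguments all_ones : clear implicits.
Arguments calD : clear implicits.
Arguments calK : clear implicits.
Arguments Gstar : clear implicits.

(* Main.v *)
Require Import Defs.
From HB Require Import structures.
From mathcomp Require Import all_boot all_order all_algebra.
From mathcomp Require Import classical_sets reals.
From mathcomp Require Import sesquilinear ring lra.

Import Order.TTheory GRing.Theory Num.Theory.
Local Open Scope ring_scope.

(** By Hadamard's inequality and AM-GM, a positive semidefinite 3x3 matrix [H]
    satisfies [det H <= (tr H / 3)^3].  For the bound on [calK], apply this to
    [H = P G P] with [P = I + J/3], where [J] is the all-ones matrix: since
    [P^2 = I + J], the trace of [H] is [tr G + u^T G u <= 4], while
    [det H = (det P)^2 det G = 4 det G]; hence [det G <= (4/3)^3 / 4 = 16/27]. *)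

Lemma det_mx33 {R : comNzRingType} (A : 'M[R]_3) :
  \det A = A 0 0 * (A 1 1 * A 2 2 - A 1 2 * A 2 1)
         - A 0 1 * (A 1 0 * A 2 2 - A 1 2 * A 2 0)
         + A 0 2 * (A 1 0 * A 2 1 - A 1 1 * A 2 0).
Proof.
(* Indexing by naturals lets the nested [lift] ordinals of the cofactor expansion compute to
   numerals, so [ring] can identify equal entries. *)
pose f i j := A (inord i) (inord j).
have fE i j : A i j = f i j by rewrite /f !inord_val.
rewrite (expand_det_row A 0) !big_ord_recl big_ord0 /cofactor.
rewrite !(expand_det_row _ 0) !big_ord_recl !big_ord0 /cofactor !det_mx11 !mxE.
rewrite !fE /= /bump /=; ring.
Qed.

Section PositiveSemidefinite.
Context {R : realType}.

Lemma symmetricmxP {n} {G : 'M[R]_n} : reflect (G^T = G) (G \is symmetricmx).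
Proof.
by rewrite is_hermitianmxE expr0 scale1r map_mx_id // eq_sym; apply: eqP.
Qed.

Lemma qformE n (G : 'M[R]_n) (x : 'cV[R]_n) :
  qform G x = \sum_i \sum_j x i 0 * G i j * x j 0.
Proof.
rewrite /qform mxE exchange_big /=; apply: eq_bigr => j _.
by rewrite mxE mulr_suml; apply: eq_bigr => i _; rewrite mxE.
Qed.

Lemma psd_congruence {n} {G : 'M[R]_n} (P : 'M[R]_n) :
  psd G -> psd (P^T *m G *m P).
Proof.
move=> [/symmetricmxP symG posG]; split=> [|x].
  by apply/symmetricmxP; rewrite !trmx_mul trmxK symG mulmxA.
by have := posG (P *m x); rewrite /qform trmx_mul !mulmxA.
Qed.

(** Test vectors supported on at most two coordinates suffice to control diagonal entries and
    principal 2x2 minors; [i = j] is allowed. *)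
Lemma qform_delta2 n (G : 'M[R]_n) (i j : 'I_n) s t :
  qform G (s *: delta_mx i 0 + t *: delta_mx j 0) =
  s ^+ 2 * G i i + s * t * (G i j + G j i) + t ^+ 2 * G j j.
Proof.
rewrite /qform [(_ + _)^T]linearD /= ![(_ *: _)^T]linearZ /= !trmx_delta.
rewrite !mulmxDl !mulmxDr.
rewrite -!scalemxAl -!scalemxAr -!rowE -!colE !mxE; ring.
Qed.

Lemma psd_sym {n} {G : 'M[R]_n} i j : psd G -> G j i = G i j.
Proof. by case=> /symmetricmxP {2}<- _; rewrite mxE. Qed.

Lemma psd_diag_ge0 {n} {G : 'M[R]_n} i : psd G -> 0 <= G i i.
Proof.
case=> _ /(_ (1 *: delta_mx i 0 + 0 *: delta_mx i 0)).
by rewrite qform_delta2; lra.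
Qed.

Lemma psd_minor2 {n} {G : 'M[R]_n} i j :
  psd G -> G i j ^+ 2 <= G i i * G j j.
Proof.
move=> psdG; have := psd_diag_ge0 i psdG; have symG := psd_sym i j psdG.
have q s t : 0 <= s ^+ 2 * G i i + s * t * (G i j *+ 2) + t ^+ 2 * G j j.
  by case: (psdG) => _ /(_ (s *: delta_mx i 0 + t *: delta_mx j 0));
    rewrite qform_delta2 symG mulr2n.
rewrite le_eqVlt => /predU1P[a0|a_gt0].
  (* With [G i i = 0], this choice makes the form equal to [- G i j ^+ 2], forcing [G i j = 0]. *)
  have := q (- (G j j + 1) / 2) (G i j); rewrite -a0; nra.
(* Here the form takes the value [G i i * (G i i * G j j - G i j ^+ 2)]. *)
rewrite -subr_ge0 -(pmulr_rge0 _ a_gt0); have := q (- G i j) (G i i); nra.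
Qed.

(** If [G 0 0 = 0], the minors kill the first row and both sides vanish. Otherwise, eliminate with
    the pivot [G 0 0]: [G 0 0 * \det G] is a product of two principal minors minus a square. *)
Lemma hadamard33 {G : 'M[R]_3} : psd G -> \det G <= G 0 0 * G 1 1 * G 2 2.
Proof.
move=> psdG; rewrite det_mx33.
rewrite (psd_sym 0 1 psdG) (psd_sym 0 2 psdG) (psd_sym 1 2 psdG).
have := psd_minor2 0 1 psdG; have := psd_minor2 0 2 psdG.
have := psd_diag_ge0 0 psdG; have := psd_diag_ge0 1 psdG.
have := psd_diag_ge0 2 psdG.
move: (G 0 0) (G 1 1) (G 2 2) (G 0 1) (G 0 2) (G 1 2) => a b c d e f.
move=> c_ge0 b_ge0; rewrite le_eqVlt => /predU1P[<-|a_gt0] ae ad.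
  have -> : d = 0 by apply/eqP; rewrite -sqrf_eq0 eq_le sqr_ge0 andbT; lra.
  have -> : e = 0 by apply/eqP; rewrite -sqrf_eq0 eq_le sqr_ge0 andbT; lra.
  lra.
rewrite -(ler_pM2l a_gt0).
have -> : a * (a * (b * c - f * f) - d * (d * c - f * e) + e * (d * f - b * e))
        = (a * b - d ^+ 2) * (a * c - e ^+ 2) - (a * f - d * e) ^+ 2 by ring.
have -> : a * (a * b * c) = (a * b) * (a * c) by ring.
have := sqr_ge0 (a * f - d * e); have := sqr_ge0 d; have := sqr_ge0 e => *.
have : (a * b - d ^+ 2) * (a * c - e ^+ 2) <= (a * b) * (a * c).
  by apply: ler_pM; lra.
lra.
Qed.

Lemma det_le_trace33 {G : 'M[R]_3} : psd G -> \det G <= (\tr G / 3) ^+ 3.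
Proof.
move=> psdG; apply: le_trans (hadamard33 psdG) _.
have := leif_AGM (A := predT) (fun i _ => psd_diag_ge0 i psdG) => -[+ _].
rewrite cardT size_enum_ord /mxtrace; apply: le_trans.
rewrite !big_ord_recl big_ord0 mulr1 mulrA.
suff [-> ->] : lift ord0 ord0 = 1 :> 'I_3 /\
               lift ord0 (lift ord0 ord0) = 2 :> 'I_3 by [].
by split; apply: val_inj.
Qed.

End PositiveSemidefinite.

Lemma psd_Gstar {R : realType} : psd (Gstar R).
Proof.
split=> [|x].
  by apply/symmetricmxP/matrixP => i j; rewrite !mxE eq_sym.
rewrite qformE !big_ord_recl !big_ord0 !mxE /=.
move: (x _ _) (x _ _) (x _ _) => a b c.
(* The form is one third of the sum of these six squares. *)
have := sqr_ge0 (a - b); have := sqr_ge0 (a - c); have := sqr_ge0 (b - c).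
have := sqr_ge0 a; have := sqr_ge0 b; have := sqr_ge0 c; lra.
Qed.

Lemma det_Gstar {R : realType} : \det (Gstar R) = 16 / 27.
Proof. by rewrite det_mx33 !mxE /=; field. Qed.

Lemma Gstar_calK {R : realType} : calK R (Gstar R).
Proof.
split; first by split=> [|i]; [apply: psd_Gstar | rewrite mxE eqxx].
rewrite qformE !big_ord_recl !big_ord0 !mxE /=; lra.
Qed.

Lemma det_calD_le1 {R : realType} {G : 'M[R]_3} : calD R G -> \det G <= 1.
Proof.
move=> [psdG diagG]; apply: le_trans (hadamard33 psdG) _.
by rewrite !mulr_ile1 ?mulr_ge0 ?psd_diag_ge0.
Qed.

Lemma det_calK_le {R : realType} {G : 'M[R]_3} : calK R G -> \det G <= 16 / 27.
Proof.
move=> [[psdG diagG] sumG].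
(* [P] is chosen so that [P *m Gstar R *m P] is 4/3 times the identity, which makes Hadamard and
   AM-GM both equalities at [Gstar]. Its eigenvalues are 1, 1, 2. *)
pose P : 'M[R]_3 := 1%:M + const_mx (1 / 3).
have detP : \det P = 2 by rewrite det_mx33 !mxE /=; field.
have PPt : P *m P^T = 1%:M + all_ones R *m (all_ones R)^T.
  apply/matrixP => i j; rewrite !mxE !big_ord_recl !big_ord0 !mxE.
  by case: i j => [[|[|[|//]]] ?] [[|[|[|//]]] ?] /=; field.
have trH : \tr (P^T *m G *m P) <= 4.
  (* By cyclicity the trace splits into [\tr G], at most 3 by the diagonal bounds, and the form at
     [all_ones], at most 1. *)
  rewrite mxtrace_mulC mulmxA PPt mulmxDl mul1mx mxtraceD.
  rewrite -mulmxA mxtrace_mulC trace_mx11 -/(qform G (all_ones R)).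
  have : \tr G <= \sum_(i < 3) 1 by apply: ler_sum => i _; apply: diagG.
  rewrite sumr_const card_ord; move: sumG; lra.
have psdH := psd_congruence P psdG; have := det_le_trace33 psdH.
rewrite !det_mulmx det_tr detP => detH.
(* Cubing preserves the bound because the trace is a sum of nonnegative diagonal entries. *)
have : (\tr (P^T *m G *m P) / 3) ^+ 3 <= (4 / 3) ^+ 3.
  rewrite lerXn2r ?nnegrE ?divr_ge0 ?ler_pM2r ?invr_gt0 //.
  by apply: sumr_ge0 => i _; apply: psd_diag_ge0.
lra.
Qed.

Theorem proposition2p3 (R : realType) :
  [/\ is_max (calD R) (fun G : 'M[R]_3 => \det G) 1,
      is_max (calK R) (fun G : 'M[R]_3 => \det G) (16 / 27),
      calK R (Gstar R)
    & \det (Gstar R) = 16 / 27].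
Proof.
split; [split | split | exact: Gstar_calK | exact: det_Gstar].
- exists 1%:M; last exact: det1.
  split; last by move=> i; rewrite mxE eqxx.
  split=> [|x]; first by apply/symmetricmxP; rewrite trmx1.
  rewrite /qform mulmx1 mxE; apply: sumr_ge0 => i _.
  by rewrite mxE -expr2 sqr_ge0.
- by move=> _ [G DG <-]; apply: det_calD_le1.
- by exists (Gstar R); [exact: Gstar_calK | exact: det_Gstar].
- by move=> _ [G KG <-]; apply: det_calK_le.
Qed.
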